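(* There is a proper class of pairwise non-isomorphic Hall-groups; equivalently, for every cardinal $\kappa$ there exists a Hall-group $G$ with $|G| > \kappa$.
   Context: A group $G$ is called a Hall-group if every group $H$ containing $G$ as a normal subgroup with $H/G \cong G$ is isomorphic to $G$. *)

(* Defs.v *)
From HB Require Import structures.
From mathcomp Require Import all_boot.
From mathcomp Require Import monoid boolp classical_sets functions cardinality.

Set Implicit Arguments.
Unset Strict Implicit.
Unset Printing Implicit Defensive.

Local Open Scope group_scope.
Local Open Scope quotient_scope.

(* Groups, possibly infinite, are the library's groupType. Its choice operator
   is no restriction, since every type has one under the axioms of boolp. *)

Definition isog (G H : groupType) : Prop :=
  exists f : {multiplicative G -> H}, bijective f.

HB.mixin Record isConjgClosed (G : groupType) (S : {pred G}) := {
  gpredJr : forall x y : G, x \in S -> x ^ y \in S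
}.

#[short(type="normalClosed")]
HB.structure Definition NormalClosed (G : groupType) :=
  {S of isConjgClosed G S & GroupClosed G S}.

Section QuotientGroup.
Variables (G : groupType) (N : normalClosed G).
Implicit Types x y z : G.

Definition coset_rel x y : bool := x^-1 * y \in N.

Fact coset_rel_refl : reflexive coset_rel.
Proof. by move=> x; rewrite /coset_rel mulVg gpred1. Qed.

Fact coset_rel_sym : symmetric coset_rel.
Proof. by move=> x y; rewrite /coset_rel -gpredV invgM invgK. Qed.

Fact coset_rel_trans : transitive coset_rel.
Proof.
move=> y x z xy yz.
have := gpredM _ _ xy yz.
by rewrite -mulgA mulVKg.
Qed.

Canonical coset_equiv : equiv_rel G :=
  EquivRel coset_rel coset_rel_refl coset_rel_sym coset_rel_trans.

Definition quotg : Type := {eq_quot coset_equiv}.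

HB.instance Definition _ : EqQuotient G coset_equiv quotg :=
  EqQuotient.on quotg.
HB.instance Definition _ := Choice.on quotg.

Definition quotg_one : quotg := lift_cst quotg 1.
Definition quotg_inv := lift_op1 quotg (fun x : G => x^-1).
Definition quotg_mul := lift_op2 quotg (fun x y : G => x * y).

Fact pi_quotg_inv : {morph \pi_quotg : x / x^-1 >-> quotg_inv x}.
Proof.
move=> x; unlock quotg_inv; apply/eqmodP; rewrite /= /coset_rel.
case: piP => y /eqmodP; rewrite /= coset_rel_sym => /(@gpredJr _ N _ y^-1).
by rewrite /conjg !invgK -mulgA mulVKg.
Qed.

Fact pi_quotg_mul : {morph \pi_quotg : x y / x * y >-> quotg_mul x y}.
Proof.
move=> x y; unlock quotg_mul; apply/eqmodP; rewrite /= /coset_rel.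
case: piP => x' /eqmodP /= Nx; case: piP => y' /eqmodP /= Ny.
have := gpredM _ _ (@gpredJr _ N _ y Nx) Ny.
by rewrite /conjg invgM !mulgA mulgK.
Qed.

Fact quotg_mulA : associative quotg_mul.
Proof.
elim/quotW => x; elim/quotW => y; elim/quotW => z.
by rewrite -!pi_quotg_mul mulgA.
Qed.

Fact quotg_mul1 : left_id quotg_one quotg_mul.
Proof.
by elim/quotW => x; unlock quotg_one; rewrite -pi_quotg_mul mul1g.
Qed.

Fact quotg_mulx1 : right_id quotg_one quotg_mul.
Proof.
by elim/quotW => x; unlock quotg_one; rewrite -pi_quotg_mul mulg1.
Qed.

Fact quotg_mulV : left_inverse quotg_one quotg_inv quotg_mul.
Proof.
elim/quotW => x; unlock quotg_one.
by rewrite -pi_quotg_inv -pi_quotg_mul mulVg.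
Qed.

Fact quotg_mulxV : right_inverse quotg_one quotg_inv quotg_mul.
Proof.
elim/quotW => x; unlock quotg_one.
by rewrite -pi_quotg_inv -pi_quotg_mul mulgV.
Qed.

HB.instance Definition _ := isGroup.Build quotg
  quotg_mulA quotg_mul1 quotg_mulx1 quotg_mulV quotg_mulxV.

End QuotientGroup.

(* "H contains G as a normal subgroup" is read up to identification: the
   normal subgroup N of H is the image of an embedding of G into H. *)
Definition Hall_group (G : groupType) : Prop :=
  forall (H : groupType) (N : normalClosed H) (i : {multiplicative G -> H}),
    injective i ->
    (forall x : H, x \in N <-> exists g : G, i g = x) ->
    isog (quotg N) G -> isog H G.

(* The universe of the carriers of groupType plays the role of the sets: index
   sets and cardinals must range over exactly this universe. Over a smaller
   one, a single group could exceed all the cardinals in question. *)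
Definition small_type := Type@{Group.axioms_.u0}.

Definition pairwise_non_isomorphic (C : groupType -> Prop) : Prop :=
  forall G H : groupType, C G -> C H -> G <> H -> ~ isog G H.

Definition proper_class (C : groupType -> Prop) : Prop :=
  ~ exists (I : small_type) (F : I -> groupType),
      forall G : groupType, C G -> exists i : I, F i = G.

Definition card_lt (T U : Type) : Prop :=
  ([set: T] #<= [set: U])%card /\ ~ ([set: U] #<= [set: T])%card.

(* Main.v *)
Require Import Defs.
From HB Require Import structures.
From mathcomp Require Import all_boot monoid.
From mathcomp Require Import boolp.

(* Let G = Sym(T)^nat, realised as the permutations of [T * nat] that preserve
   the fibres of the projection to [nat], for T infinite and large.  The
   transpositions are recognisable inside G by the orders of the commutators
   they form, so every automorphism of G is conjugation by a permutation of
   [T * nat] permuting the fibres; hence Out(G) = Sym(nat), and G has trivial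
   centre.  By an Eilenberg swindle together with the pigeonhole
   principle, G has no nontrivial homomorphism to a monoid of cardinality less
   than |T|, in particular none to Sym(nat).  So in an extension H of G by G,
   every element of H acts on the normal copy of G as an inner automorphism,
   H is the direct product of that copy and its centraliser, and
   H ~ G x G ~ G.  Letting T vary gives Hall groups of arbitrarily large
   cardinality, and a class of representatives of all the isomorphism types of
   Hall groups cannot be indexed by a set. *)

Set Implicit Arguments.
Unset Strict Implicit.
Unset Printing Implicit Defensive.

Local Open Scope group_scope.

(** * Fibre-preserving permutations *)

Record fperm (I X : Type) (c : X -> I) := FPerm {
  fperm_fun :> X -> X;
  fperm_inv : X -> X;
  fperm_funK : cancel fperm_fun fperm_inv;
  fperm_invK : cancel fperm_inv fperm_fun;
  fperm_fib : forall x, c (fperm_fun x) = c x }.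

Section FPermGroup.
Variables (I X : Type) (c : X -> I).
Implicit Types g h k : fperm c.

Lemma fpermP g h : g =1 h -> g = h.
Proof.
case: g h => [g g' gK g'K cg] [h h' hK h'K ch] /= /funext eqgh.
subst h; have eqgh' : g' = h'.
  by apply: funext => x; rewrite -{1}[x]h'K gK.
by subst h'; congr FPerm; apply: Prop_irrelevance.
Qed.

Lemma fperm_fibV g x : c (fperm_inv g x) = c x.
Proof. by rewrite -{2}[x](fperm_invK g) fperm_fib. Qed.

Definition fperm_one : fperm c :=
  @FPerm _ _ c id id (fun=> erefl) (fun=> erefl) (fun=> erefl).

Fact fperm_mul_fib g h x : c (g (h x)) = c x.
Proof. by rewrite !fperm_fib. Qed.

Definition fperm_mul g h : fperm c :=
  FPerm (can_comp (@fperm_funK _ _ _ g) (@fperm_funK _ _ _ h))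
        (can_comp (@fperm_invK _ _ _ h) (@fperm_invK _ _ _ g))
        (@fperm_mul_fib g h).

Definition fperm_opp g : fperm c :=
  FPerm (@fperm_invK _ _ _ g) (@fperm_funK _ _ _ g) (@fperm_fibV g).

HB.instance Definition _ := gen_eqMixin (fperm c).
HB.instance Definition _ := gen_choiceMixin (fperm c).

Fact fperm_mulA : associative fperm_mul.
Proof. by move=> g h k; apply: fpermP. Qed.
Fact fperm_mul1 : left_id fperm_one fperm_mul.
Proof. by move=> g; apply: fpermP. Qed.
Fact fperm_mulx1 : right_id fperm_one fperm_mul.
Proof. by move=> g; apply: fpermP. Qed.
Fact fperm_mulV : left_inverse fperm_one fperm_opp fperm_mul.
Proof. by move=> g; apply: fpermP => x /=; apply: fperm_funK. Qed.
Fact fperm_mulxV : right_inverse fperm_one fperm_opp fperm_mul.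
Proof. by move=> g; apply: fpermP => x /=; apply: fperm_invK. Qed.

HB.instance Definition _ := isGroup.Build (fperm c)
  fperm_mulA fperm_mul1 fperm_mulx1 fperm_mulV fperm_mulxV.

Lemma fperm1E x : (1 : fperm c) x = x. Proof. by []. Qed.
Lemma fpermM g h x : (g * h) x = g (h x). Proof. by []. Qed.
Lemma fpermK g : cancel g g^-1. Proof. exact: fperm_funK. Qed.
Lemma fpermKV g : cancel g^-1 g. Proof. exact: fperm_invK. Qed.
Lemma fperm_inj g : injective g. Proof. exact: can_inj (fpermK g). Qed.

Definition fperm_invol (f : X -> X) (fK : involutive f)
  (cf : forall x, c (f x) = c x) : fperm c := FPerm fK fK cf.

Lemma fperm_involV f fK cf :
  (@fperm_invol f fK cf)^-1 = @fperm_invol f fK cf.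
Proof. exact: fpermP. Qed.

End FPermGroup.

(** * Transpositions and automorphisms *)

Section Transpositions.
Variables (I X : eqType) (c : X -> I).
Implicit Types (g h t : fperm c) (x y z : X).

(** Points of different fibres give the identity, so [trV], [trK], [trC] and [trJ] hold
    unconditionally. *)
Definition tr_fun x y z :=
  if c x != c y then z else if z == x then y else if z == y then x else z.

Fact tr_funK x y : involutive (tr_fun x y).
Proof.
move=> z; rewrite /tr_fun; case: (c x != c y) => //.
by case: (z =P x) => ?; case: (z =P y) => ?;
  repeat (case: eqP => ?); congruence.
Qed.

Fact tr_fun_fib x y z : c (tr_fun x y z) = c z.
Proof.
rewrite /tr_fun; case: (c x =P c y) => //= ?.
by do 2?[case: eqP => ?]; congruence.
Qed.

Definition tr x y : fperm c := fperm_invol (tr_funK x y) (tr_fun_fib x y).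

Lemma trE x y z : c x = c y ->
  tr x y z = if z == x then y else if z == y then x else z.
Proof. by move=> cxy; rewrite /tr /= /tr_fun cxy eqxx. Qed.

Lemma trL x y : c x = c y -> tr x y x = y.
Proof. by move=> cxy; rewrite trE// eqxx. Qed.

Lemma trR x y : c x = c y -> tr x y y = x.
Proof. by move=> cxy; rewrite trE// eqxx; case: eqP. Qed.

Lemma trD x y z : z <> x -> z <> y -> tr x y z = z.
Proof.
move=> /eqP/negPf zx /eqP/negPf zy.
by rewrite /tr /= /tr_fun zx zy if_same.
Qed.

Lemma trV x y : (tr x y)^-1 = tr x y.
Proof. exact: fperm_involV. Qed.

Lemma trK x y : tr x y * tr x y = 1.
Proof. by rewrite -{2}trV mulgV. Qed.

Lemma trC x y : tr x y = tr y x.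
Proof.
apply: fpermP => z; rewrite /tr /= /tr_fun eq_sym; case: (c y != c x) => //.
by case: (z =P x) => ?; case: (z =P y) => ?; congruence.
Qed.

Lemma trJ g x y : g * tr x y * g^-1 = tr (g x) (g y).
Proof.
apply: fpermP => z; rewrite !fpermM -{2}[z](fpermKV g).
set w := g^-1 z; rewrite /tr /= /tr_fun !fperm_fib.
case: (c x != c y) => //; rewrite !(inj_eq (@fperm_inj _ _ _ g)).
by do !case: ifP.
Qed.

Lemma tr_commute g x y : g x = x -> g y = y -> g * tr x y = tr x y * g.
Proof. by move=> gx gy; rewrite -{2}gx -{2}gy -trJ mulgVK. Qed.

Lemma tr_moves x y z : tr x y z <> z ->
  [/\ c x = c y, x <> y & z = x \/ z = y].
Proof.
rewrite /tr /= /tr_fun; case: (c x =P c y) => //= cxy.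
case: eqP => [->|zx]; first by move=> yx; split; auto; congruence.
by case: eqP => [->|//] xy; split; auto.
Qed.

Lemma tr_moves2 x y a b : a <> b -> tr x y a <> a -> tr x y b <> b ->
  tr x y = tr a b.
Proof.
move=> ab /tr_moves[cxy xy xa] /tr_moves[_ _ xb].
by case: xa xb ab => -> [] -> // _; rewrite trC.
Qed.

Lemma tr_ncommute x y z : c x = c y -> c x = c z -> x <> y -> x <> z ->
  tr x y * tr x z = tr x z * tr x y -> y = z.
Proof.
move=> cxy cxz xy xz /(congr1 (fun f : fperm c => f x)).
rewrite !fpermM !trL// => e; apply: contrapT => yz.
by move: e; rewrite !trD //; congruence.
Qed.

Lemma tr_inj x y z : c x = c y -> c x = c z -> tr x y = tr x z -> y = z.
Proof.
by move=> cxy cxz /(congr1 (fun f : fperm c => f x)); rewrite !trL.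
Qed.

(* This condition characterises the transpositions inside the group: for a
   transposition [t], [t * g * t * g^-1] is a product of two transpositions. *)
Definition is_reflection t := [/\ t <> 1, t * t = 1 & forall g,
  let u := t * g * t * g^-1 in u * u = 1 \/ u * u * u = 1].

(** With [s] and [r] the two transpositions, the cube of [s * r] is [s * r * s] times [r * s * r],
    and both of these are [tr y z]. *)
Lemma tr_braid x y z : c x = c y -> c x = c z -> x <> y -> x <> z -> y <> z ->
  let u := tr x y * tr x z in u * u * u = 1.
Proof.
move=> cxy cxz xy xz yz u; rewrite /u.
have e1 : tr x y * tr x z * tr x y = tr y z.
  by rewrite -{2}trV trJ trL // trD //; congruence.
have e2 : tr x z * tr x y * tr x z = tr y z.
  by rewrite -{2}trV trJ trL // trD // ?[tr z y]trC //; congruence.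
have -> : tr x y * tr x z * (tr x y * tr x z) * (tr x y * tr x z)
   = tr x y * tr x z * tr x y * (tr x z * tr x y * tr x z) by rewrite !mulgA.
by rewrite e1 e2 trK.
Qed.

Lemma tr_reflection x y : c x = c y -> x <> y -> is_reflection (tr x y).
Proof.
move=> cxy xy; split.
- move=> /(congr1 (fun f : fperm c => f x)).
  by rewrite trL // fperm1E; congruence.
- exact: trK.
move=> g /=; have -> : tr x y * g * tr x y * g^-1 = tr x y * tr (g x) (g y).
  by rewrite -trJ !mulgA.
have gxy : g x <> g y by move=> e; apply: xy; apply: (@fperm_inj _ _ _ g).
have cg : c (g x) = c (g y) by rewrite !fperm_fib.
have cgx : c (g x) = c x by rewrite fperm_fib.
move: (g x) (g y) gxy cg cgx => a b ab cab cax.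
have [xa|xa] := pselect (tr x y a = a); have [xb|xb] := pselect (tr x y b = b).
- left; rewrite {1}(tr_commute xa xb) mulgA -[X in X * _]mulgA trK mulg1.
  exact: trK.
- right; case: (tr_moves xb) => _ _ [] eb; subst b.
    rewrite [tr a x]trC; apply: tr_braid => //; try congruence.
    by move=> ya; move: xa; rewrite -ya trR //; congruence.
  rewrite [tr a y]trC [tr x y]trC; apply: tr_braid => //; try congruence.
  by move=> ya; move: xa; rewrite -ya trL //; congruence.
- right; case: (tr_moves xa) => _ _ [] ea; subst a.
    apply: tr_braid => //; try congruence.
    by move=> ya; move: xb; rewrite -ya trR //; congruence.
  rewrite [tr x y]trC; apply: tr_braid => //; try congruence.
  by move=> ya; move: xb; rewrite -ya trL //; congruence.
- by left; rewrite (tr_moves2 ab xa xb) !trK mulg1.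
Qed.

Hypothesis fresh :
  forall (x : X) (s : seq X), exists2 y, c y = c x & y \notin s.

(** If [t] moves [x] but is not [tr x (t x)], it moves a further point [p]; some [g] is then built
    for which [t * g * t * g^-1] has order dividing neither 2 nor 3. *)
Lemma reflection_tr t : is_reflection t ->
  exists x y, [/\ c x = c y, x <> y & t = tr x y].
Proof.
case=> t1 tt Ht; have tK z : t (t z) = z by rewrite -fpermM tt.
have [x xt] : exists x, t x <> x.
  by apply: contrapT => H; apply: t1; apply: fpermP => x;
     apply: contrapT => Hx; apply: H; exists x.
exists x, (t x); split; [by rewrite fperm_fib|by move/esym|].
have cx : c x = c (t x) by rewrite fperm_fib.
apply: contrapT => ntr.
have [p tp] : exists p, t p <> tr x (t x) p.
  by apply: contrapT => H; apply: ntr; apply: fpermP => p;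
     apply: contrapT => Hp; apply: H; exists p.
have px : p <> x by move=> px; apply: tp; rewrite px trL.
have ptx : p <> t x by move=> ptx; apply: tp; rewrite ptx trR.
have {}tp : t p <> p by move: tp; rewrite trD.
(* Otherwise [t] moves almost all points of the fibre of [w], which leaves
   room for a 4-cycle [g] whose support is disjoint from its image under [t];
   then [t * g * t * g^-1] acts as [g^-1] on the support of [g]. *)
have F w (s : seq X) : exists z, [/\ c z = c w, z \notin s & t z = z].
  apply: contrapT => H.
  have mv z : c z = c w -> z \notin s -> t z <> z.
    by move=> cz zs tz; apply: H; exists z.
  have [z1 c1 n1] := fresh w s.
  have [z2 c2 n2] := fresh w [:: z1, t z1 & s].
  have [z3 c3 n3] := fresh w [:: z1, t z1, z2, t z2 & s].
  have [z4 c4 n4] := fresh w [:: z1, t z1, z2, t z2, z3, t z3 & s].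
  move: n2 n3 n4; rewrite !inE !negb_or.
  move=> /and3P[/eqP n21 /eqP n21' n2].
  move=> /and5P[/eqP n31 /eqP n31' /eqP n32 /eqP n32' n3].
  move=> /and5P[/eqP n41 /eqP n41' /eqP n42 /eqP n42'].
  move=> /and3P[/eqP n43 /eqP n43' n4].
  have m1 := mv _ c1 n1; have m2 := mv _ c2 n2.
  have m3 := mv _ c3 n3; have m4 := mv _ c4 n4.
  have t12 : t z2 <> z1 by move=> e; apply: n21'; rewrite -e tK.
  have t13 : t z3 <> z1 by move=> e; apply: n31'; rewrite -e tK.
  have t14 : t z4 <> z1 by move=> e; apply: n41'; rewrite -e tK.
  have t23 : t z3 <> z2 by move=> e; apply: n32'; rewrite -e tK.
  have t24 : t z4 <> z2 by move=> e; apply: n42'; rewrite -e tK.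
  have t34 : t z4 <> z3 by move=> e; apply: n43'; rewrite -e tK.
  pose g := tr z1 z2 * tr z2 z3 * tr z3 z4.
  have gV : g^-1 = tr z3 z4 * (tr z2 z3 * tr z1 z2).
    by rewrite /g !invgM !trV.
  have v1 : g^-1 z1 = z4.
    by rewrite gV !fpermM trL ?c1 ?c2// trL ?c2 ?c3// trL ?c3 ?c4.
  have v4 : g^-1 z4 = z3.
    by rewrite gV !fpermM (@trD z1) // (@trD z2) // trR ?c3 ?c4.
  have v3 : g^-1 z3 = z2.
    rewrite gV !fpermM (@trD z1) // trR ?c2 ?c3//.
    by apply: trD; congruence.
  have fix_g z : z <> z1 -> z <> z2 -> z <> z3 -> z <> z4 -> g z = z.
    by move=> zz1 zz2 zz3 zz4; rewrite /g !fpermM !trD.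
  have u1 : t (g (t (g^-1 z1))) = z4 by rewrite v1 fix_g ?tK.
  have u4 : t (g (t (g^-1 z4))) = z3.
    by rewrite v4 fix_g ?tK //; move=> e; apply: n43'; rewrite -e.
  have u3 : t (g (t (g^-1 z3))) = z2.
    by rewrite v3 fix_g ?tK //; move=> e; [apply: n32'|apply: n42']; rewrite -e.
  (* The square and the cube of [t * g * t * g^-1] send [z1] to [z3] and to [z2]. *)
  case: (Ht g) => /(congr1 (fun f : fperm c => f z1));
    by rewrite !fpermM u1 u4 ?u3 fperm1E; congruence.
have [a [ca na ta]] := F x [::].
have [b [cb nb tb]] := F p [:: a].
have [d [cd nd td]] := F p [:: a; b].
move: nb nd; rewrite !inE negb_or => /eqP nb /andP[/eqP nda /eqP ndb].
(* This [g] makes [t * g * t * g^-1] exchange [p] and [t p], so its cube is not 1, and send [x] to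
   the fixed point [a] of [t] but not [a] back to [x], so its square is not 1. *)
pose g := tr (t x) a * tr p b * tr (t p) d.
have gV : g^-1 = tr (t p) d * (tr p b * tr (t x) a).
  by rewrite /g !invgM !trV.
have xb : x <> b by congruence. have xd : x <> d by congruence.
have xa : x <> a by congruence. have txa : t x <> a by congruence.
have pa : p <> a by congruence. have pb : p <> b by congruence.
have pd : p <> d by congruence.
have tpb : t p <> b by move=> e; apply: pb; rewrite -(tK p) e.
have tpd : t p <> d by move=> e; apply: pd; rewrite -(tK p) e.
have tpa : t p <> a by move=> e; apply: pa; rewrite -(tK p) e.
have txb : t x <> b by move=> e; apply: xb; rewrite -(tK x) e.
have txd : t x <> d by move=> e; apply: xd; rewrite -(tK x) e.
have tpx : t p <> x by move=> e; apply: ptx; rewrite -(tK p) e.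
have tptx : t p <> t x by move=> e; apply: px; apply: (@fperm_inj _ _ _ t).
have ctp : c (t p) = c p by rewrite fperm_fib.
have ctx : c (t x) = c a by rewrite fperm_fib.
have ctd : c (t p) = c d by rewrite fperm_fib.
have vp : g^-1 p = b.
  rewrite gV !fpermM (@trD (t x)) // (@trD (t p)) ?trL //; congruence.
have gb : g b = p.
  rewrite /g !fpermM (@trD (t p)) // ?trR ?(@trD (t x)) //; congruence.
have vtp : g^-1 (t p) = d.
  by rewrite gV !fpermM (@trD (t x)) // (@trD p) // trL.
have gd : g d = t p.
  by rewrite /g !fpermM trR // (@trD p) // ?(@trD (t x)) //; congruence.
have vx : g^-1 x = x.
  by rewrite gV !fpermM !trD //; congruence.
have gtx : g (t x) = a.
  by rewrite /g !fpermM (@trD (t p)) // ?(@trD p) ?trL //; congruence.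
have va : g^-1 a = t x.
  by rewrite gV !fpermM trR // (@trD p) // ?(@trD (t p)) //; congruence.
have gx : g x = x.
  by rewrite /g !fpermM !trD //; congruence.
have up : t (g (t (g^-1 p))) = t p by rewrite vp tb gb.
have utp : t (g (t (g^-1 (t p)))) = p by rewrite vtp td gd tK.
have ux : t (g (t (g^-1 x))) = a by rewrite vx gtx ta.
have ua : t (g (t (g^-1 a))) <> x by rewrite va tK gx.
case: (Ht g) => [/(congr1 (fun f : fperm c => f x))|
                 /(congr1 (fun f : fperm c => f p))]; rewrite !fpermM fperm1E.
  by rewrite ux.
by rewrite up utp up.
Qed.

(** * Automorphisms as conjugations by permutations of the points *)

Section Automorphism.
Variable al be : fperm c -> fperm c.
Hypothesis alM : {morph al : g h / g * h}.
Hypothesis beK : cancel be al.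

Lemma morph_fperm1 : al 1 = 1.
Proof. by apply: (mulgI (al 1)); rewrite -alM !mulg1. Qed.

Lemma morph_fpermV g : al g^-1 = (al g)^-1.
Proof. by apply: (mulgI (al g)); rewrite -alM !mulgV morph_fperm1. Qed.

Hypothesis alK : cancel al be.

Lemma aut_reflection t : is_reflection t -> is_reflection (al t).
Proof.
case=> t1 tt Ht; split.
- by move=> e; apply/t1/(can_inj alK); rewrite e morph_fperm1.
- by rewrite -alM tt morph_fperm1.
move=> g; rewrite -(beK g) -morph_fpermV /= -!alM -morph_fperm1.
by case: (Ht (be g)) => /= ->; [left|right].
Qed.

Lemma aut_tr x y : c x = c y -> x <> y ->
  exists a b, [/\ c a = c b, a <> b & al (tr x y) = tr a b].
Proof. by move=> cxy xy; apply/reflection_tr/aut_reflection/tr_reflection. Qed.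

(* If [al] is conjugation by a permutation [p], this says that [a = p x]. *)
Definition tracks x a := forall w, c w = c x -> w <> x -> al (tr x w) a <> a.

(** The images of [tr x y] and [tr x z] are transpositions that do not commute, so they share
    exactly one point, which is the one sought. *)
Lemma tracks_exists x : exists a, tracks x a.
Proof.
have [y cy /[!inE] /eqP yx] := fresh x [:: x].
have [z cz /[!inE] /norP[/eqP zx /eqP zy]] := fresh x [:: x; y].
have [p [q [cpq pq eq1]]] := aut_tr (esym cy) (nesym yx).
have [p' [q' [cpq' pq' eq2]]] := aut_tr (esym cz) (nesym zx).
have nc : al (tr x y) * al (tr x z) <> al (tr x z) * al (tr x y).
  rewrite -!alM => /(can_inj alK) /tr_ncommute e.
  by apply: zy; apply/esym; apply: e => //; congruence.
have [e [u [v [ceu cev [eu ev uv] e1 e2]]]] : exists e u v,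
  [/\ c e = c u, c e = c v, [/\ e <> u, e <> v & u <> v],
      al (tr x y) = tr e u & al (tr x z) = tr e v].
  have [m|m] := pselect (al (tr x y) p' = p').
    have [m'|m'] := pselect (al (tr x y) q' = q').
      by case: nc; rewrite eq2; apply: tr_commute.
    rewrite eq1 in m m'; have [_ _ [] E] := tr_moves m'.
      exists p, q, p'; split=> //; try congruence.
      - by split; try congruence; move=> E'; move: m;
          rewrite -E' trR //; congruence.
      - by rewrite eq2 trC E.
    exists q, p, p'; split=> //; try congruence.
    - by split; try congruence; move=> E'; move: m;
        rewrite -E' trL //; congruence.
    - by rewrite eq1 trC.
    - by rewrite eq2 trC E.
  have [m'|m'] := pselect (al (tr x y) q' = q').
    rewrite eq1 in m m'; have [_ _ [] E] := tr_moves m.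
      exists p, q, q'; split=> //; try congruence.
      by split; try congruence; move=> E'; move: m';
        rewrite -E' trR //; congruence.
    exists q, p, q'; split=> //; try congruence.
    - by split; try congruence; move=> E'; move: m';
        rewrite -E' trL //; congruence.
    - by rewrite eq1 trC.
  by case: nc; rewrite eq2 eq1 in m m' *; rewrite (tr_moves2 pq' m m').
exists e => w cw wx.
have [->|wy] := eqVneq w y; first by rewrite e1 trL //; congruence.
have [->|wz] := eqVneq w z; first by rewrite e2 trL //; congruence.
move/eqP in wy; move/eqP in wz.
have [a [b [cab ab e3]]] := aut_tr (esym cw) (nesym wx).
have nc1 : al (tr x w) * al (tr x y) <> al (tr x y) * al (tr x w).
  rewrite -!alM => /(can_inj alK) /tr_ncommute E.
  by apply: wy; apply: E; congruence.
have nc2 : al (tr x w) * al (tr x z) <> al (tr x z) * al (tr x w).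
  rewrite -!alM => /(can_inj alK) /tr_ncommute E.
  by apply: wz; apply: E; congruence.
(* If [al (tr x w)] fixed the common point [e], it would have to move both [u] and [v], since it
   commutes with neither image; it would then be [tr u v], which is already the image of
   [tr y z]. *)
move=> fe.
have mu : al (tr x w) u <> u.
  by move=> fu; apply: nc1; rewrite e1; apply: tr_commute.
have mv : al (tr x w) v <> v.
  by move=> fv; apply: nc2; rewrite e2; apply: tr_commute.
have e4 : al (tr x w) = tr u v by rewrite e3 in mu mv *; apply: tr_moves2.
have e5 : al (tr y z) = tr u v.
  have -> : tr y z = tr x y * tr x z * (tr x y)^-1.
    by rewrite trJ trL // trD.
  rewrite !alM morph_fpermV e1 e2 trJ trL // trD //; congruence.
have : tr x w x = tr y z x.
  by congr (fperm_fun _ x); apply: (can_inj alK); rewrite e4.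
by rewrite trL // trD; congruence.
Qed.

Lemma tracks_uniq x a b : tracks x a -> tracks x b -> a = b.
Proof.
move=> ta tb; apply: contrapT => ab.
have [y cy /[!inE] /eqP yx] := fresh x [:: x].
have [z cz /[!inE] /norP[/eqP zx /eqP zy]] := fresh x [:: x; y].
have [p [q [cpq pq eq1]]] := aut_tr (esym cy) (nesym yx).
have [p' [q' [cpq' pq' eq2]]] := aut_tr (esym cz) (nesym zx).
apply: zy; apply/esym; apply: (@tr_inj x) => //; apply: (can_inj alK).
have := (ta y cy yx, tb y cy yx, ta z cz zx, tb z cz zx).
rewrite eq1 eq2 => -[[[m1 m2] m3] m4].
by rewrite (tr_moves2 ab m1 m2) (tr_moves2 ab m3 m4).
Qed.

(** If [a] served both points, disjoint transpositions at [x] and at [y] would have commuting images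
    that both move [a], hence equal images. *)
Lemma tracks_inj x y a : tracks x a -> tracks y a -> x = y.
Proof.
move=> tx ty; apply: contrapT => xy.
have [x' cx /[!inE] /norP[/eqP x'x /eqP x'y]] := fresh x [:: x; y].
have [y' cy /[!inE] /norP[/eqP y'x /norP[/eqP y'y /eqP y'x']]] :=
  fresh y [:: x; y; x'].
have := (tx x' cx x'x, ty y' cy y'y).
have [p [q [cpq pq eq1]]] := aut_tr (esym cx) (nesym x'x).
have [p' [q' [cpq' pq' eq2]]] := aut_tr (esym cy) (nesym y'y).
have cm : al (tr x x') * al (tr y y') = al (tr y y') * al (tr x x').
  by rewrite -!alM tr_commute // trD //; congruence.
have ne : al (tr x x') <> al (tr y y').
  move/(can_inj alK)/(congr1 (fun f : fperm c => f x)).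
  by rewrite trL // trD //; congruence.
have star p0 q0 : c p0 = c q0 -> p0 <> q0 -> tr p0 q0 a <> a ->
    exists b, [/\ c a = c b, a <> b & tr p0 q0 = tr a b].
  move=> c0 d0 /tr_moves[_ _ [] ->]; first by exists q0.
  by exists p0; split; [exact: esym|exact: nesym|exact: trC].
rewrite eq1 eq2 => -[/(star _ _ cpq pq)[b [cab ab E1]]
  /(star _ _ cpq' pq')[b' [cab' ab' E2]]].
apply: ne; rewrite eq1 eq2 E1 E2; congr tr.
by apply: (tr_ncommute cab cab' ab ab'); rewrite -E1 -E2 -eq1 -eq2.
Qed.

Lemma tracks_tr x y a b : c x = c y -> x <> y -> tracks x a -> tracks y b ->
  [/\ a <> b, c a = c b & al (tr x y) = tr a b].
Proof.
move=> cxy xy ta tb.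
have ab : a <> b by move=> E; apply: xy; apply: tracks_inj ta _; rewrite E.
have := (ta y (esym cxy) (nesym xy), tb x cxy xy); rewrite [tr y x]trC.
have [p [q [cpq pq ->]]] := aut_tr cxy xy => -[ma mb].
have E := tr_moves2 ab ma mb; split => //.
by move: ma; rewrite E => /tr_moves[].
Qed.

(** [al g] conjugates the image of [tr x y] into that of [tr (g x) (g y)], so it takes [a] to [b] or
    to the point [d] with [tracks (g y) d]; two choices of [y] leave only [b]. *)
Lemma tracks_conj g x a b : tracks x a -> tracks (g x) b -> al g a = b.
Proof.
move=> ta tb.
have step y : c y = c x -> y <> x -> forall d, tracks (g y) d ->
    al g a = b \/ al g a = d.
  move=> cy yx d td.
  have [a' ta'] := tracks_exists y.
  have [aa' caa' E] := tracks_tr (esym cy) (nesym yx) ta ta'.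
  have gxy : g x <> g y.
    by move=> e; apply/yx/esym/(@fperm_inj _ _ _ g).
  have cg : c (g x) = c (g y) by rewrite !fperm_fib.
  have [bd cbd E'] := tracks_tr cg gxy tb td.
  have : tr (al g a) (al g a') = tr b d.
    by rewrite -E' -!trJ -E -morph_fpermV -!alM.
  move/(congr1 (fun f : fperm c => f (al g a))).
  rewrite trL ?fperm_fib // => E2.
  have /tr_moves[] // : tr b d (al g a) <> al g a.
  by rewrite -E2 => e; apply: aa'; apply/esym; apply: (@fperm_inj _ _ _ (al g)).
have [y cy /[!inE] /eqP yx] := fresh x [:: x].
have [z cz /[!inE] /norP[/eqP zx /eqP zy]] := fresh x [:: x; y].
have [d td] := tracks_exists (g y); have [d' td'] := tracks_exists (g z).
have [//|ed] := step y cy yx d td; have [//|ed'] := step z cz zx d' td'.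
case: zy; apply: (@fperm_inj _ _ _ g); apply: (tracks_inj td').
by rewrite -ed' ed.
Qed.

Lemma conj_tracks (p : X -> X) : injective p ->
  (forall g x, al g (p x) = p (g x)) -> forall x, tracks x (p x).
Proof. by move=> pI pJ x w cw wx; rewrite pJ trL // => /pI. Qed.

End Automorphism.

Lemma aut_perm (al be : fperm c -> fperm c) :
  {morph al : g h / g * h} -> cancel al be -> cancel be al ->
  exists p p' : X -> X, [/\ cancel p p', cancel p' p,
    forall x y, c x = c y -> c (p x) = c (p y) &
    forall g x, al g (p x) = p (g x)].
Proof.
move=> alM alK beK.
have beM : {morph be : g h / g * h}.
  by move=> g h; apply: (can_inj alK); rewrite alM !beK.
have [p tp] := choice (tracks_exists alM beK alK).
have [p' tp'] := choice (tracks_exists beM alK beK).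
(* Stated for a generic pair, as it serves for [al] and [be] in both orders. Applying [be1] and then
   [al1] to [tr x y] gives it back, so [q (q' x)] is [x] or [y]; a second partner [z] of [x] leaves
   only [x]. *)
have pK al1 be1 (al1M : {morph al1 : g h / g * h}) (al1K : cancel al1 be1)
    (be1K : cancel be1 al1) (be1M : {morph be1 : g h / g * h}) q q' :
    (forall x, tracks al1 x (q x)) -> (forall x, tracks be1 x (q' x)) ->
    cancel q' q.
  move=> tq tq' x.
  have step y : c y = c x -> y <> x -> q (q' x) = x \/ q (q' x) = y.
    move=> cy yx.
    have [d cd E] :=
      tracks_tr be1M al1K be1K (esym cy) (nesym yx) (tq' x) (tq' y).
    have [d' cd' E'] := tracks_tr al1M be1K al1K cd d (tq _) (tq _).
    have /tr_moves[] // : tr x y (q (q' x)) <> q (q' x).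
    by rewrite -(be1K (tr x y)) E E' trL //; exact: nesym.
  have [y cy /[!inE] /eqP yx] := fresh x [:: x].
  have [z cz /[!inE] /norP[/eqP zx /eqP zy]] := fresh x [:: x; y].
  by have [//|e1] := step y cy yx; have [//|e2] := step z cz zx; congruence.
exists p, p'; split.
- exact: (pK be al).
- exact: (pK al be).
- move=> x y cxy; have [->//|/eqP xy] := eqVneq x y.
  by have [] := tracks_tr alM beK alK cxy xy (tp x) (tp y).
- by move=> g x; apply: (tracks_conj alM beK alK) (tp _).
Qed.

(** Uniqueness later turns the composition law of automorphisms into one for the permutations that
    induce them. *)
Lemma aut_perm_uniq (al be : fperm c -> fperm c) (p q : X -> X) :
  {morph al : g h / g * h} -> cancel al be -> cancel be al ->
  injective p -> injective q ->
  (forall g x, al g (p x) = p (g x)) -> (forall g x, al g (q x) = q (g x)) ->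
  p =1 q.
Proof.
move=> alM alK beK pI qI pJ qJ x.
by apply: (tracks_uniq alM beK alK); apply: conj_tracks.
Qed.

End Transpositions.

(** * Small quotients *)

Section Extension.
Variables (I X Y : Type) (c : X -> I) (cY : Y -> I) (e : Y -> X).
Hypotheses (eI : injective e) (ce : forall y, c (e y) = cY y).

Definition ext_fun (h : Y -> Y) x :=
  if pselect (exists y, e y = x) is left ex then e (h (projT1 (cid ex))) else x.

Lemma ext_funE h y : ext_fun h (e y) = e (h y).
Proof.
rewrite /ext_fun; case: pselect => [ex|[]]; last by exists y.
by case: (cid ex) => y' /= ey; rewrite (eI ey).
Qed.

Lemma ext_fun_out h x : (forall y, e y <> x) -> ext_fun h x = x.
Proof.
move=> ex; rewrite /ext_fun; case: pselect => // -[y ey].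
by case: (ex y).
Qed.

Lemma imageVout x : (exists y, e y = x) \/ (forall y, e y <> x).
Proof.
have [|ex] := pselect (exists y, e y = x); first by left.
by right=> y ey; apply: ex; exists y.
Qed.

Fact ext_funK h k : cancel h k -> cancel (ext_fun h) (ext_fun k).
Proof.
move=> hK x; have [[y <-]|ex] := imageVout x; first by rewrite !ext_funE hK.
by rewrite (ext_fun_out h ex) (ext_fun_out k ex).
Qed.

Fact ext_fun_fib (h : fperm cY) x : c (ext_fun h x) = c x.
Proof.
have [[y <-]|ex] := imageVout x; first by rewrite ext_funE !ce fperm_fib.
by rewrite ext_fun_out.
Qed.

Definition fext (h : fperm cY) : fperm c :=
  FPerm (ext_funK (@fperm_funK _ _ _ h)) (ext_funK (@fperm_invK _ _ _ h))
        (ext_fun_fib h).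

Lemma fextE h y : fext h (e y) = e (h y). Proof. exact: ext_funE. Qed.

Lemma fext_out h x : (forall y, e y <> x) -> fext h x = x.
Proof. exact: ext_fun_out. Qed.

Lemma fextM g h : fext (g * h) = fext g * fext h.
Proof.
apply: fpermP => x; rewrite fpermM.
have [[y <-]|ex] := imageVout x; first by rewrite !fextE.
by rewrite !fext_out // fext_out.
Qed.

Lemma fext1 : fext 1 = 1.
Proof. by apply: (mulgI (fext 1)); rewrite -fextM !mulg1. Qed.

End Extension.

Section Swap.
Variables (I X J : Type) (c : X -> I) (a b : J -> X).
Hypotheses (aI : injective a) (bI : injective b) (ab : forall i j, a i <> b j).
Hypothesis cab : forall j, c (b j) = c (a j).

Let e (s : J + J) := match s with inl j => a j | inr j => b j end.
Let ce (s : J + J) := match s with inl j | inr j => c (a j) end.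
Let flip (s : J + J) := match s with inl j => inr j | inr j => inl j end.

Fact swap_embed : injective e.
Proof.
case=> i [] j /= E; first by rewrite (aI E).
- by case: (ab E).
- by case: (ab (esym E)).
- by rewrite (bI E).
Qed.

Fact swap_embed_fib s : c (e s) = ce s.
Proof. by case: s => j /=. Qed.

Fact swap_flipK : involutive flip. Proof. by case. Qed.

Fact swap_flip_fib s : ce (flip s) = ce s. Proof. by case: s. Qed.

Definition swap : fperm c :=
  fext swap_embed swap_embed_fib (fperm_invol swap_flipK swap_flip_fib).

Lemma swapL j : swap (a j) = b j.
Proof. exact: (fextE swap_embed swap_embed_fib _ (inl j)). Qed.

Lemma swapR j : swap (b j) = a j.
Proof. exact: (fextE swap_embed swap_embed_fib _ (inr j)). Qed.

Lemma swapD x : (forall j, a j <> x) -> (forall j, b j <> x) -> swap x = x.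
Proof. by move=> ax bx; apply: fext_out => -[]. Qed.

Lemma swapK : swap * swap = 1.
Proof.
rewrite -fextM -[RHS](fext1 swap_embed swap_embed_fib); congr fext.
by apply: fpermP => -[].
Qed.

End Swap.

(** * The Eilenberg swindle *)

Section SmallQuotient.
Variables (I X : Type) (P : eqType) (c : X -> I).

Local Notation Z := (bool * nat)%type.

(* [(true, n)] encodes the integer [n] and [(false, n)] encodes [- n - 1]. *)
Definition zsucc (z : Z) : Z := match z with
  | (true, n) => (true, n.+1)
  | (false, n.+1) => (false, n)
  | (false, 0) => (true, 0) end.
Definition zpred (z : Z) : Z := match z with
  | (true, n.+1) => (true, n)
  | (true, 0) => (false, 0)
  | (false, n) => (false, n.+1) end.
Fact zsuccK : cancel zsucc zpred. Proof. by case=> -[] []. Qed.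
Fact zpredK : cancel zpred zsucc. Proof. by case=> -[] []. Qed.

Local Notation W := (X * P * Z)%type.
Let cW (w : W) := c w.1.1.

Section Slot.
Variables (g : fperm c) (p : P).

(** The boolean [w.2.1] selects the nonnegative integers, so [h] acts on only half of the copies of
    [X] in slot [p]. *)
Let slot_fun (h : X -> X) (w : W) : W :=
  (if (w.1.2 == p) && w.2.1 then h w.1.1 else w.1.1, w.1.2, w.2).

Fact slot_funK h k : cancel h k -> cancel (slot_fun h) (slot_fun k).
Proof.
move=> hK [[x q] [b n]]; rewrite /slot_fun /=.
by case: ((q == p) && b); rewrite ?hK.
Qed.

Fact slot_fun_fib w : cW (slot_fun g w) = cW w.
Proof. by rewrite /cW /slot_fun /=; case: ifP; rewrite ?fperm_fib. Qed.

Definition slot : fperm cW :=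
  FPerm (slot_funK (fpermK g)) (slot_funK (fpermKV g)) slot_fun_fib.

Let shift_fun (s : Z -> Z) (w : W) : W :=
  (w.1, if w.1.2 == p then s w.2 else w.2).

Fact shift_funK s r : cancel s r -> cancel (shift_fun s) (shift_fun r).
Proof.
move=> sK [[x q] z]; rewrite /shift_fun /=.
by case: (q == p); rewrite ?sK.
Qed.

Definition shift : fperm cW :=
  @FPerm _ _ cW _ _ (shift_funK zsuccK) (shift_funK zpredK) (fun=> erefl).

(** In slot [p], [slot] acts by [g] at every integer from 0 on, and the conjugate of its inverse by
    [shift] acts by [g^-1] from 1 on, so only the copy at 0 survives. *)
Lemma slot_commutatorE w : (slot * (shift * (slot^-1 * shift^-1))) w =
  (if (w.1.2 == p) && (w.2 == (true, 0)) then g w.1.1 else w.1.1, w.1.2, w.2).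
Proof.
case: w => [[x q] z]; rewrite !fpermM /= /slot_fun /shift_fun /=.
case: (q =P p) => //= _; rewrite zpredK.
by case: z => -[] [|n] //=; rewrite fpermKV.
Qed.

End Slot.

Lemma slot_shift g p q : p != q -> slot g q * shift p = shift p * slot g q.
Proof.
move=> /negPf pq; apply: fpermP => -[[x r] z]; rewrite !fpermM.
by rewrite /slot /shift /=; case: (r =P p) => [->|//]; rewrite pq.
Qed.

Section Kernel.
Variables (K : Type) (phi : fperm c -> K).
(** The fibres of [phi] form a congruence: [phi] is a homomorphism to a monoid formed by its image,
    without a product given on [K]. *)
Hypothesis phiM : forall g g' h h',
  phi g = phi g' -> phi h = phi h' -> phi (g * h) = phi (g' * h').
Hypothesis small : forall F : P -> K, exists p q, p != q /\ F p = F q.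

(* By [small] two slots carry the same image; the Eilenberg swindle then
   kills the commutator of one of them with its shift, a conjugate of [g]. *)
Lemma small_quotient_fix (d : W -> X) (g : fperm c) :
  injective d -> (forall w, c (d w) = c w.1.1) ->
  (forall w, g (d w) = d w) -> phi g = phi 1.
Proof.
move=> dI cd gd.
have [p [q [pq Fpq]]] := small (fun p => phi (fext dI cd (slot g p))).
pose L := fext dI cd.
pose x0 := slot g p * (shift p * ((slot g p)^-1 * (shift p)^-1)).
have phi_x0 : phi (L x0) = phi 1.
  (* Only the first factor passes to slot [q], where it commutes with [shift p]; passing back to
     slot [p], it cancels against its inverse. *)
  have -> : phi (L x0) =
      phi (L (slot g q * (shift p * ((slot g p)^-1 * (shift p)^-1)))).
    by rewrite /L !(fextM dI cd); apply: phiM => //; rewrite Fpq.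
  rewrite mulgA slot_shift // -mulgA.
  have -> : 1 = L (shift p * (slot g p * ((slot g p)^-1 * (shift p)^-1))).
    by rewrite mulgA mulgA mulgK mulgV /L fext1.
  by rewrite /L !(fextM dI cd); apply: phiM => //; apply: phiM.
(* [L x0] acts by [g] on the copy [d (x, p, (true, 0))] of the points, while [g] itself moves only
   points off the range of [d]. The involution [s] exchanges each point off the range with its copy,
   and so conjugates [L x0] to [g]. *)
pose J := {y | forall w, d w <> y}.
pose a (y : J) := sval y.
pose b (y : J) := d (sval y, p, (true, 0)).
have aI : injective a by case=> y ny [z nz] /= yz; apply: eq_exist.
have bI : injective b by move=> y z /dI[] /aI.
have ab i j : a i <> b j by move=> e; apply: (svalP i (sval j, p, (true, 0))).
have cab j : c (b j) = c (a j) by rewrite cd.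
have [s [ss sb sa sd]] : exists s : fperm c, [/\ s * s = 1,
    forall y, (forall w, d w <> y) -> s (d (y, p, (true, 0))) = y,
    forall y, (forall w, d w <> y) -> s y = d (y, p, (true, 0)) &
    forall w, ~ (exists j, b j = d w) -> s (d w) = d w].
  exists (swap aI bI ab cab); split; first exact: swapK.
  - by move=> y ny; apply: (swapR aI bI ab cab (exist _ y ny)).
  - by move=> y ny; apply: (swapL aI bI ab cab (exist _ y ny)).
  - move=> w nw; apply: swapD => [[x nx] /= xw|j bj].
      by apply: (nx w).
    by apply: nw; exists j.
have Lout y : (forall w, d w <> y) -> L x0 y = y by apply: fext_out.
have LE w : L x0 (d w) = d (if (w.1.2 == p) && (w.2 == (true, 0))
    then g w.1.1 else w.1.1, w.1.2, w.2).
  by rewrite /L fextE slot_commutatorE.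
move: (L x0) phi_x0 Lout LE => l phi_l lout lE.
have sE : s * l * s = g.
  apply: fpermP => y; rewrite !fpermM.
  have [[w <-]|ny] := imageVout d y; last first.
    rewrite (sa y) // lE /= !eqxx /= sb // => w gy; apply: (ny w).
    by apply: (@fperm_inj _ _ _ g); rewrite gd.
  rewrite gd; have [ew|nw] := pselect (exists j, b j = d w).
    have [[x nx] /= xw] := ew; rewrite -xw {1}/b /= sb //.
    by rewrite (lout x) // sa.
  have sw := sd w nw; rewrite sw lE; case: w => [[x r] z] /= in nw sw *.
  case: ifP => [/andP[/eqP rp /eqP zE]|_]; last exact: sw.
  have [[w' xw']|nx] := imageVout d x.
    by rewrite -xw' gd xw'.
  by case: nw; exists (exist _ x nx); rewrite /b /= rp zE.
have ss1 : s * 1 * s = 1 by rewrite mulg1.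
rewrite -sE -[in RHS]ss1; apply: phiM => //; exact: phiM.
Qed.

End Kernel.

End SmallQuotient.

(** * Small quotients of powers of a symmetric group *)

Section FiberPower.
Variables (I : Type) (T : eqType) (pr : T * T -> T) (zt : bool * nat -> T).
Hypotheses (prI : injective pr) (ztI : injective zt).

Local Notation X := (T * I)%type.
Local Notation G := (fperm (snd : X -> I)).

(** [k false] and [k true] cut out two disjoint copies of [T], and [pr] splits the first into rows.
    Either [g] keeps some row off the second copy, and [m] is that row; or each row has a point that
    [g] sends there, and these points form a copy [e] of [T] disjoint from its image, with room for
    all three maps. *)
Lemma disjoint_triple (g : T -> T) : injective g -> exists m d1 d2 : T -> T,
  [/\ injective m, injective d1, injective d2 & forall s t,
  [/\ m s <> d1 t, d1 s <> g (m t), m s <> d2 t, g (m s) <> d2 t &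
      d1 s <> d2 t]].
Proof.
move=> gI; pose k b t := pr (zt (b, 0), t).
have kI b : injective (k b) by move=> s t /prI[].
have kD s t : k false s <> k true t by move=> /prI[/ztI].
have [[s Hs]|H] := pselect (exists s, forall t u,
    g (k false (pr (s, t))) <> k true u).
  exists (fun t => k false (pr (s, t))), (fun t => k true (k true t)),
    (fun t => k true (k false t)); split.
  - by move=> t u /kI/prI[].
  - by move=> t u /kI/kI.
  - by move=> t u /kI/kI.
  by move=> t u; split=> //; [move/esym/Hs|move/kI/esym/kD].
have /choice[ta taE] : forall s, exists t, exists u,
    g (k false (pr (s, t))) = k true u.
  move=> s; apply: contrapT => Hs; apply: H; exists s => t u tu.
  by apply: Hs; exists t, u.
pose e s := k false (pr (s, ta s)).
have eI : injective e by move=> s t /kI/prI[].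
have ge s u : g (e s) <> e u.
  by have [v] := taE s => gE eE; apply: (kD _ v); rewrite -gE -/(e s) eE.
exists (e \o k false \o k false), (e \o k false \o k true), (e \o k true);
  split; [by do 2![apply: inj_comp => //]..|by apply: inj_comp|].
move=> s t /=; split => //.
- by move/eI/kI/kD.
- by move/esym/ge.
- by move/eI/kD.
- by move/eI/kD.
Qed.

Variables (K : Type) (phi : G -> K).
Hypothesis phiM : forall g g' h h',
  phi g = phi g' -> phi h = phi h' -> phi (g * h) = phi (g' * h').
Hypothesis small : forall F : T -> K, exists p q, p != q /\ F p = F q.

(** Through [pr] and [zt], the fixed copy of [T] in each fibre absorbs a slot index in [T] and an
    integer, which gives the embedding that [small_quotient_fix] demands. *)
Lemma small_quotient_fix_fiber (g : G) (m : I -> T -> T) :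
  (forall i, injective (m i)) ->
  (forall i t, g (m i t, i) = (m i t, i)) -> phi g = phi 1.
Proof.
move=> mI gm.
pose d (w : X * T * (bool * nat)) :=
  (m w.1.1.2 (pr (w.1.1.1, pr (w.1.2, zt w.2))), w.1.1.2).
apply: (small_quotient_fix phiM small (d := d)) => //.
  move=> [[[t i] p] z] [[[t' i'] p'] z'] [+ /= ei]; subst i'.
  by move=> /mI/prI[-> /prI[-> /ztI ->]].
by move=> w; apply: gm.
Qed.

Theorem small_quotient_trivial (g : G) : phi g = phi 1.
Proof.
pose gf i t := (g (t, i)).1.
have gfE i t : g (t, i) = (gf i t, i).
  by rewrite [LHS]surjective_pairing; congr pair; apply: (fperm_fib g).
have gfI i : injective (gf i).
  move=> s t e; have [] // : (s, i) = (t, i).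
  by apply: (@fperm_inj _ _ _ g); rewrite !gfE e.
have [m] := choice (fun i => disjoint_triple (gfI i)).
move=> /choice[d1] /choice[d2] H.
have mI i : injective (m i) by case: (H i).
have d1I i : injective (d1 i) by case: (H i).
have d2I i : injective (d2 i) by case: (H i).
pose lift (f : I -> T -> T) (x : X) : X := (f x.2 x.1, x.2).
have liftI f : (forall i, injective (f i)) -> injective (lift f).
  by move=> fI [s i] [t j] [+ /= ij]; subst j => /= /fI ->.
have md i j : lift m i <> lift d1 j.
  case: i j => [s i] [t j] [+ /= ij]; subst j => /=.
  by case: (H i) => _ _ _ /(_ s t)[].
have dg i j : lift d1 i <> g (lift m j).
  case: i j => [s i] [t j]; rewrite gfE => -[+ /= ij]; subst j => /=.
  by case: (H i) => _ _ _ /(_ s t)[].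
have gmI : injective (g \o lift m).
  by apply: inj_comp (liftI _ mI); apply: fperm_inj.
(* [h2 * h1] agrees with [g] on the range of [lift m], so that [g] is a
   product of three elements fixing pointwise a copy of each fibre. *)
pose h1 : G := swap (c := snd) (liftI _ mI) (liftI _ d1I) md (fun=> erefl).
pose h2 : G := swap (c := snd) (liftI _ d1I) gmI dg (fun j => fperm_fib g _).
have h1K : h1 * h1 = 1 by apply: swapK.
have h2K : h2 * h2 = 1 by apply: swapK.
have h1E : phi h1 = phi 1.
  apply: (@small_quotient_fix_fiber h1 d2) => // i t.
  apply: swapD => -[s j] [+ ij]; rewrite /= in ij; subst j => /=;
    by case: (H i) => _ _ _ /(_ s t)[]; congruence.
have h2E : phi h2 = phi 1.
  apply: (@small_quotient_fix_fiber h2 d2) => // i t; apply: swapD => -[s j].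
    move=> [+ ij]; rewrite /= in ij; subst j => /=.
    by case: (H i) => _ _ _ /(_ s t)[]; congruence.
  rewrite /= gfE => -[+ ij]; rewrite /= in ij; subst j => /=.
  by case: (H i) => _ _ _ /(_ s t)[]; congruence.
have rE : phi (h1 * (h2 * g)) = phi 1.
  apply: (@small_quotient_fix_fiber _ m) => // i t; rewrite !fpermM.
  have -> : h2 (g (m i t, i)) = lift d1 (t, i).
    exact: (swapR (c := snd) (liftI _ d1I) gmI dg _ (t, i)).
  exact: (swapR (c := snd) (liftI _ mI) (liftI _ d1I) md _ (t, i)).
have -> : g = h2 * (h1 * (h1 * (h2 * g))).
  by rewrite (mulgA h1 h1) h1K mul1g (mulgA h2 h2) h2K mul1g.
have -> : 1 = 1 * (1 * 1) :> G by rewrite !mul1g.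
by apply: phiM => //; apply: phiM.
Qed.

End FiberPower.

(** * Extensions *)

Lemma isogI (G H : groupType) (f : G -> H) :
  {morph f : x y / x * y} -> bijective f -> isog G H.
Proof.
move=> fM fB; pose F : {multiplicative G -> H} :=
  HB.pack f (isMultiplicative.Build G H f fM).
by exists F.
Qed.

Section Quotient.
Variables (H : groupType) (N : normalClosed H).
Local Open Scope quotient_scope.

Lemma pi_quotgM (x y : H) :
  \pi_(quotg N) (x * y) = \pi_(quotg N) x * \pi_(quotg N) y.
Proof. exact: pi_quotg_mul. Qed.

Lemma pi_quotg_eq (x y : H) :
  \pi_(quotg N) x = \pi_(quotg N) y <-> x^-1 * y \in N.
Proof. by split=> [/eqmodP|xy]; [|apply/eqmodP]. Qed.

Lemma pi_quotg1 : \pi_(quotg N) 1 = 1.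
Proof. by apply: (mulgI (\pi_(quotg N) 1)); rewrite -pi_quotgM !mulg1. Qed.

End Quotient.

(** * Countable powers of a large symmetric group are Hall groups *)

Section HallPower.
Variables (T : eqType) (pr : T * T -> T) (zt : bool * nat -> T).
Hypotheses (prI : injective pr) (ztI : injective zt).

Local Notation X := (T * nat)%type.
Local Notation G := (fperm (snd : X -> nat)).

Lemma fiber_fresh (x : X) (s : seq X) : exists2 y : X, y.2 = x.2 & y \notin s.
Proof.
pose f n : X := (zt (true, n), x.2).
have fI : injective f by move=> m n [/ztI []].
apply: contrapT => H; pose r := [seq f n | n <- iota 0 (size s).+1].
have : size r <= size s.
  apply: uniq_leq_size; first by rewrite map_inj_uniq ?iota_uniq.
  move=> _ /mapP[n _ ->]; apply: contrapT => /negP fs.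
  by apply: H; exists (f n).
by rewrite size_map size_iota ltnn.
Qed.

(** Splitting [nat] into even and odd numbers yields an isomorphism of [G x G] with [G]: [g] fills
    the even fibres and [h] the odd ones. *)
Let merge_fun (g h : X -> X) (x : X) : X :=
  ((if odd x.2 then h (x.1, x.2./2) else g (x.1, x.2./2)).1, x.2).

Fact merge_funK (g h g' h' : G) : cancel g g' -> cancel h h' ->
  cancel (merge_fun g h) (merge_fun g' h').
Proof.
move=> gK hK [t n]; rewrite /merge_fun /=; congr pair.
have E (k : G) u m : ((k (u, m)).1, m) = k (u, m).
  by rewrite [RHS]surjective_pairing; congr pair; rewrite (fperm_fib k).
by case: (odd n); rewrite E ?gK ?hK.
Qed.

Definition merge (g h : G) : G :=
  @FPerm _ _ snd _ _ (@merge_funK g h g^-1 h^-1 (fpermK g) (fpermK h))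
    (@merge_funK g^-1 h^-1 g h (fpermKV g) (fpermKV h)) (fun=> erefl).

Lemma mergeE g h t n : merge g h (t, n) =
  ((if odd n then h (t, n./2) else g (t, n./2)).1, n).
Proof. by []. Qed.

Lemma fperm_pair (g : G) t n : g (t, n) = ((g (t, n)).1, n).
Proof.
by rewrite [LHS]surjective_pairing; congr pair; apply: (fperm_fib g).
Qed.

Lemma mergeM g g' h h' : merge (g * g') (h * h') = merge g h * merge g' h'.
Proof.
apply: fpermP => -[t n]; rewrite fpermM !mergeE.
by case: (odd n); rewrite fpermM -fperm_pair.
Qed.

Lemma merge_inj g g' h h' : merge g h = merge g' h' -> g = g' /\ h = h'.
Proof.
move=> E; split; apply: fpermP => -[t n]; rewrite fperm_pair [RHS]fperm_pair;
  congr pair.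
- have := congr1 (fun k : G => (k (t, n.*2)).1) E.
  by rewrite !mergeE odd_double doubleK.
- have := congr1 (fun k : G => (k (t, n.*2.+1)).1) E.
  by rewrite !mergeE /= odd_double uphalf_double.
Qed.

Lemma merge_surj (k : G) : exists g h, k = merge g h.
Proof.
pose half b (m : X -> X) (x : X) : X := ((m (x.1, b + x.2.*2)).1, x.2).
have halfK (b : bool) (m m' : G) : cancel m m' -> cancel (half b m) (half b m').
  move=> mK [t n]; rewrite /half /=; congr pair.
  by rewrite -fperm_pair mK.
pose hk b : G := @FPerm _ _ snd _ _ (halfK b k k^-1 (fpermK k))
   (halfK b k^-1 k (fpermKV k)) (fun=> erefl).
exists (hk false), (hk true); apply: fpermP => -[t n].
rewrite mergeE fperm_pair; congr pair.
have -> : (if odd n then hk true (t, n./2) else hk false (t, n./2)) =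
    ((k (t, odd n + n./2.*2)).1, n./2) by case: (odd n).
by rewrite odd_double_half.
Qed.

Hypothesis small :
  forall F : T -> (nat -> nat), exists p q, p != q /\ F p = F q.

Theorem Hall_power : Hall_group G.
Proof.
move=> H N i iI iN [f fB].
have [f' fK f'K] := fB.
have /choice[al alE] : forall h, exists a : G -> G,
    forall k, i (a k) = h * i k * h^-1.
  move=> h; suff /choice[a aE] : forall k, exists k', i k' = h * i k * h^-1.
    by exists a.
  move=> k.
  apply/iN; have /(@gpredJr _ N _ h^-1) : i k \in N by apply/iN; exists k.
  by rewrite /conjg invgK mulgA.
have i1 : i 1 = 1 by apply: (mulgI (i 1)); rewrite -gmulfM !mulg1.
have alM h : {morph al h : g g' / g * g'}.
  by move=> g g'; apply: iI; rewrite gmulfM !alE gmulfM !mulgA mulgVK.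
have alC h h' g : al (h * h') g = al h (al h' g).
  by apply: iI; rewrite !alE invgM !mulgA.
have al1 g : al 1 g = g by apply: iI; rewrite alE invg1 mul1g mulg1.
have alK h : cancel (al h) (al h^-1) by move=> g; rewrite -alC mulVg al1.
have alKV h : cancel (al h^-1) (al h) by move=> g; rewrite -alC mulgV al1.
have /choice[p pP] : forall h, exists p : X -> X, [/\ bijective p,
    forall x y, x.2 = y.2 -> (p x).2 = (p y).2 &
    forall g x, al h g (p x) = p (g x)].
  move=> h; have [p [p' [pK p'K pc pJ]]] :=
    aut_perm fiber_fresh (alM h) (alK h) (alKV h).
  by exists p; split => //; exists p'.
have pI h : injective (p h) by case: (pP h) => /bij_inj.
have pc h x y : x.2 = y.2 -> (p h x).2 = (p h y).2.
  by case: (pP h) => _ + _; apply.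
have pJ h g x : al h g (p h x) = p h (g x) by case: (pP h).
have p_uniq h q :
    injective q -> (forall g x, al h g (q x) = q (g x)) -> p h =1 q.
  by move=> qI qJ; apply: (aut_perm_uniq fiber_fresh (alM h) (alK h) (alKV h)).
have pM h h' x : p (h * h') x = p h (p h' x).
  apply: (p_uniq _ (p h \o p h')); first exact: inj_comp.
  by move=> g y /=; rewrite alC pJ pJ.
have p_i k x : p (i k) x = k x.
  apply: p_uniq; first exact: fperm_inj.
  move=> g y; have -> : al (i k) g = k * g * k^-1.
    apply: iI; rewrite alE !gmulfM; congr (_ * _).
    by apply: (mulgI (i k)); rewrite -gmulfM !mulgV i1.
  by rewrite !fpermM fpermK.
pose hh g := repr (f' g).
have hhE g : \pi_(quotg N)%qT (hh g) = f' g by rewrite /hh reprK.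
have coset_i h h' : \pi_(quotg N)%qT h = \pi_(quotg N)%qT h' ->
    exists k, h' = h * i k.
  by move=> /pi_quotg_eq/iN[k kE]; exists k; rewrite kE mulVKg.
have f'M g g' : f' (g * g') = f' g * f' g'.
  by apply: (can_inj fK); rewrite gmulfM !f'K.
(* [phi g] is the action on fibre indices of any element in the coset given by [g]: the first
   coordinate of [base j] is arbitrary, and changing the representative by some [i k] keeps every
   fibre. *)
pose base (j : nat) : X := (zt (true, 0), j).
pose phi g j := (p (hh g) (base j)).2.
have phiE h x : (p h x).2 = phi (f (\pi_(quotg N)%qT h)) x.2.
  have [|k hE] := coset_i (hh (f (\pi_(quotg N)%qT h))) h.
    by rewrite hhE fK.
  by rewrite {1}hE pM; apply: pc; rewrite p_i (fperm_fib k).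
have phiM g g' : phi (g * g') = phi g \o phi g'.
  apply: funext => j; rewrite /= -[in RHS](f'K g) -[in RHS](f'K g') -!hhE.
  have [|k hE] := coset_i (hh g * hh g') (hh (g * g')).
    by rewrite pi_quotgM !hhE f'M.
  rewrite -[j in RHS]/((base j).2) -!phiE /phi hE !pM p_i.
  by do 2!apply: (pc); rewrite (fperm_fib k).
(* [phi] is multiplicative into the self-maps of [nat], too few for a nontrivial quotient; so it is
   constant, and at 1 it is the identity. *)
have phi1 g : phi g = id.
  have -> : phi g = phi 1.
    apply: (small_quotient_trivial prI ztI _ small) => g1 g2 h1 h2 e1 e2.
    by rewrite !phiM e1 e2.
  apply: funext => j; rewrite -[in LHS](f'K 1) -[j in LHS]/((base j).2) .
  have f'1 : f' 1 = \pi_(quotg N)%qT 1.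
    by rewrite pi_quotg1; apply: (mulgI (f' 1)); rewrite -f'M !mulg1.
  by rewrite f'1 -phiE -i1 p_i.
have p_fib h x : (p h x).2 = x.2 by rewrite phiE phi1.
have /choice[ga gaE] : forall h, exists g : G, g =1 p h.
  move=> h; have [[q pK qK] _ _] := pP h.
  by exists (FPerm pK qK (p_fib h)).
have gaM h h' : ga (h * h') = ga h * ga h'.
  by apply: fpermP => x; rewrite fpermM !gaE pM.
have ga_i k : ga (i k) = k by apply: fpermP => x; rewrite gaE p_i.
(* [ga] retracts [H] onto the normal copy of [G], so [ga h] and the class of [h] together identify
   [H] with [G x H/N]; [merge] turns this pair into an element of [G]. *)
pose F h := merge (ga h) (f (\pi_(quotg N)%qT h)).
have FM : {morph F : h h' / h * h'}.
  by move=> h h'; rewrite /F gaM pi_quotgM gmulfM mergeM.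
have FI : injective F.
  move=> h h' /merge_inj[e1 /(can_inj fK)/coset_i[k hE]].
  suff k1 : k = 1 by rewrite hE k1 i1 mulg1.
  by apply: (mulgI (ga h)); rewrite mulg1 [RHS]e1 hE gaM ga_i.
have FS g : exists h, F h = g.
  have [a [b ->]] := merge_surj g.
  (* [h] has the right class; a factor from [N] corrects [ga h] to [a] without changing that
     class. *)
  pose h := hh b; exists (i (a * (ga h)^-1) * h); rewrite /F gaM ga_i mulgVK.
  congr merge; rewrite pi_quotgM.
  have -> : \pi_(quotg N)%qT (i (a / ga h)) = 1.
    rewrite -pi_quotg1; apply/esym/pi_quotg_eq; rewrite invg1 mul1g.
    by apply/iN; exists (a / ga h).
  by rewrite mul1g hhE f'K.
have [F' F'K] := choice FS.
by apply: (isogI FM); exists F' => // h; apply: FI; rewrite F'K.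
Qed.

End HallPower.

From mathcomp Require Import classical_sets functions cardinality.

(** * Cardinalities and representatives *)

Section Carrier.
Variable U : Type.

(** A power set, hence larger than [U] by Cantor; the factor [nat] lets two subsets be interleaved,
    which embeds the square without cardinal arithmetic. *)
Definition carrier := nat * U -> bool.
HB.instance Definition _ := gen_eqMixin carrier.

Definition interleave (fg : carrier * carrier) : carrier := fun nu =>
  (if odd nu.1 then fg.2 else fg.1) (nu.1./2, nu.2).

Lemma interleave_inj : injective interleave.
Proof.
move=> [f g] [f' g'] E; congr pair; apply: funext => -[n u].
- have := congr1 (@^~ (n.*2, u)) E.
  by rewrite /interleave /= odd_double doubleK.
- have := congr1 (@^~ (n.*2.+1, u)) E.
  by rewrite /interleave /= odd_double uphalf_double.
Qed.

Definition indicator (z : bool * nat) : carrier := fun nu => nu.1 == pickle z.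

Lemma indicator_inj (u : U) : injective indicator.
Proof.
move=> z z' /(congr1 (@^~ (pickle z, u))); rewrite /indicator /= eqxx.
by move/esym/eqP/(pcan_inj pickleK).
Qed.

Lemma no_inj_pred (j : (U -> bool) -> U) : ~ injective j.
Proof.
move=> jI; pose D u := `[< exists2 S, j S = u & ~~ S u >].
have [Dj|/negP nDj] := boolP (D (j D)).
  have /asboolP[S /jI SD] := Dj; by rewrite SD Dj.
by apply: (nDj); apply/asboolP; exists D => //; apply/negP.
Qed.

Lemma carrier_no_inj (F : carrier -> U) : ~ injective F.
Proof.
move=> FI; apply: (@no_inj_pred (fun S => F (fun nu => S nu.2))) => S S' /FI E.
by apply: funext => u; have := congr1 (@^~ (0, u)) E.
Qed.

End Carrier.

Lemma inj_card_leT (T U : Type) (f : T -> U) :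
  injective f -> ([set: T] #<= [set: U])%card.
Proof.
move=> fI; suff [F] : $|{injfun [set: T] >-> [set: U]}| by apply: inj_card_le F.
by apply/injfunPex; exists f => // x y _ _ /fI.
Qed.

Lemma card_leT_inj (T U : Type) :
  ([set: T] #<= [set: U])%card -> exists f : T -> U, injective f.
Proof.
move=> /card_leP[F].
have mT t : t \in [set: T]%classic by rewrite in_setT.
exists (fun t => val (F (SigSub (mT t)))) => t t' /val_inj.
by move=> /(@inj _ _ _ F) => /(_ (in_setT _) (in_setT _)) [].
Qed.

Theorem large_Hall_group (kappa : small_type) :
  exists G : groupType, Hall_group G /\ card_lt kappa G.
Proof.
(* The two summands put [T] beyond [kappa], for size, and beyond the self-maps of [nat], for the
   pigeonhole hypothesis of [Hall_power]. *)
pose U : Type := (kappa + (nat -> nat))%type.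
pose T : eqType := carrier U.
have zI := indicator_inj (inr id : U).
have small (F : T -> nat -> nat) : exists p q, p != q /\ F p = F q.
  apply: contrapT => H; apply: (@carrier_no_inj U (fun t => inr (F t))).
  by move=> p q [Fpq]; apply: contrapT => /eqP pq; apply: H; exists p, q.
pose X := (T * nat)%type; pose G := fperm (snd : X -> nat).
exists G; split; first exact: (Hall_power (@interleave_inj U) zI small).
pose k b (t : T) : X := (interleave (indicator (b, 0) : T, t), 0).
(* Transpositions of one fixed point with varying points of fibre 0 embed [T] in [G]. *)
pose j (t : T) : G := tr snd (k false ((fun=> false) : T)) (k true t).
have jI : injective j.
  move=> s t E.
  have [/interleave_inj[]//] : k true s = k true t.
  exact: (@tr_inj _ _ snd (k false (fun=> false)) (k true s) (k true t)
    erefl erefl E).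
split.
  have up : exists f : kappa -> T, injective f.
    exists (fun x => fun nu => `[< nu.2 = inl x >]) => x y.
    move/(congr1 (@^~ (0, inl x)))=> /= E.
    have : `[< inl x = inl x :> U >] by apply/asboolP.
    by rewrite E => /asboolP[].
  by have [f fI] := up; apply: (inj_card_leT (f := j \o f)); apply: inj_comp.
move=> /card_leT_inj[f fI]; apply: (@carrier_no_inj U (inl \o f \o j)).
by apply: inj_comp => //; apply: inj_comp => // x y [].
Qed.

(** * Representatives of isomorphism classes *)

Lemma isog_refl G : isog G G.
Proof. by apply: (isogI (f := id)) => //; exists id. Qed.

Lemma isog_sym G H : isog G H -> isog H G.
Proof.
move=> [f [g fK gK]]; apply: (isogI (f := g)); last by exists f.
by move=> x y; apply: (can_inj fK); rewrite gmulfM !gK.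
Qed.

Lemma isog_trans G H K : isog G H -> isog H K -> isog G K.
Proof.
move=> [f fB] [g gB]; apply: (isogI (f := g \o f)); last exact: bij_comp.
by move=> x y /=; rewrite !gmulfM.
Qed.

Lemma Hall_group_isog (G G' : groupType) :
  isog G G' -> Hall_group G -> Hall_group G'.
Proof.
move=> GG' hG H N i iI iN q; have [f [g fK gK]] := GG'.
apply: (isog_trans _ GG'); pose i' : {multiplicative G -> H} := i \o f.
apply: (hG H N i').
- by apply: inj_comp => //; apply: can_inj fK.
- move=> x; rewrite iN; split=> -[y <-]; last by exists (f y).
  by exists (g y); rewrite /= gK.
- exact/(isog_trans q)/isog_sym.
Qed.

(** Choosing from predicates rather than from groups makes the choice depend only on the isomorphism
    class, as isomorphic groups have extensionally equal predicates [isog G]. *)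
Lemma isog_representatives : exists rep : groupType -> groupType,
  (forall G, isog G (rep G)) /\ (forall G H, isog G H -> rep G = rep H).
Proof.
have /choice[e eP] : forall Q : groupType -> Prop,
    exists G, (exists H, Q H) -> Q G.
  move=> Q; have [[H QH]|nQ] := pselect (exists H, Q H); first by exists H.
  by exists (fperm (@id unit)).
exists (fun G => e (isog G)); split=> [G|G H GH].
  by apply: (eP (isog G)); exists G; apply: isog_refl.
congr e; apply: funext => K; apply/propext; split; last exact: isog_trans.
exact/isog_trans/isog_sym.
Qed.

Theorem mainTheorem3 :
  (exists C : groupType -> Prop,
     (forall G : groupType, C G -> Hall_group G) /\
     pairwise_non_isomorphic C /\
     proper_class C) /\
  (forall kappa : small_type,
     exists G : groupType, Hall_group G /\ card_lt kappa G).
Proof.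
split; last exact: large_Hall_group.
have [rep [repP repE]] := isog_representatives.
exists (fun G => Hall_group G /\ rep G = G); split; first by move=> G [].
split=> [G H [_ rG] [_ rH] GH /repE|[I [F FP]]]; first by rewrite rG rH.
(* The disjoint union of the groups [F i] is the cardinal to exceed: every Hall group is isomorphic
   to its representative, which is some [F i], and so injects into that union. *)
have [G [hG [_ nG]]] := large_Hall_group {i : I & F i}.
have [i Fi] : exists i, F i = rep G.
  apply: FP; split; first exact: Hall_group_isog (repP G) hG.
  exact/esym/repE.
apply: nG; have := repP G; rewrite -Fi => -[f /bij_inj fI].
apply: (inj_card_leT (f := fun x => existT F i (f x))) => x y E.
apply: fI; have := projT2_eq E; rewrite /=.
by rewrite (Prop_irrelevance (projT1_eq E) erefl).
Qed.
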